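(* Consider the generalized Meixner weight $w(k)=\frac{(a)_k}{(b+1)_k}\frac{\eta^k}{k!}$, $k\in\mathbb N_0$, i.e. the case $\sigma(z)=\eta(z+a)$, $\theta(z)=z(z+b)$ of the Pearson equation $\theta(k+1)w(k+1)=\sigma(k)w(k)$. Then the Laguerre--Freud structure matrix $\Psi=(\Psi_{n,m})_{n,m\in\mathbb N_0}$ is the banded matrix with entries, for all $n\in\mathbb N_0$, $$\Psi_{n+1,n}=\eta H_{n+1},\qquad \Psi_{n,n}=\eta(\beta_n+a+n)H_n,$$ $$\Psi_{n,n+1}=(\beta_n+\beta_{n+1}+b-n)H_{n+1},\qquad \Psi_{n,n+2}=H_{n+2},$$ and all other entries equal to zero.
   Context: $\mathbb N_0=\{0,1,2,\dots\}$; $(x)_k=x(x+1)\cdots(x+k-1)$. The parameters are real with $a(b+1)>0$, $\eta>0$, $b+1\notin\{0,-1,-2,\dots\}$, and it is assumed that all Hankel determinants $\det(\rho_{i+j})_{i,j=0}^{k-1}$, $k\ge1$, of the moments $\rho_n=\sum_{k\ge0}k^nw(k)$ are nonzero. Then there are monic orthogonal polynomials $P_n$, $\deg P_n=n$, with $\sum_{k\ge0}P_n(k)P_m(k)w(k)=\delta_{n,m}H_n$, $H_n\ne0$, satisfying $zP_n(z)=P_{n+1}(z)+\beta_nP_n(z)+\gamma_nP_{n-1}(z)$, $P_{-1}=0$, with $\gamma_{n+1}=H_{n+1}/H_n$. Rows and columns of semi-infinite matrices are indexed by $\mathbb N_0$. $J$ is the tridiagonal Jacobi matrix with $J_{n,n}=\beta_n$,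 $J_{n,n+1}=1$, $J_{n+1,n}=\gamma_{n+1}$; $H=\operatorname{diag}(H_0,H_1,\dots)$; $P(z)=(P_0(z),P_1(z),\dots)^\top$. The dressed Pascal matrix $\Pi$ is the lower unitriangular semi-infinite matrix determined by $P(z+1)=\Pi P(z)$. For a weight satisfying $\theta(k+1)w(k+1)=\sigma(k)w(k)$, $k\in\mathbb N_0$, with polynomials $\theta,\sigma$, $\theta(0)=0$, the Laguerre--Freud structure matrix is $\Psi:=\Pi^{-1}H\theta(J^\top)$, which also equals $\sigma(J)H\Pi^\top$. *)

(* Defs.v *)
From mathcomp Require Import all_boot all_order all_algebra.
From mathcomp Require Import all_classical all_reals all_analysis.
From mathcomp Require Import ring.

Set Implicit Arguments.
Unset Strict Implicit.
Unset Printing Implicit Defensive.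

Import Order.TTheory GRing.Theory Num.Theory.
Import numFieldNormedType.Exports.

Local Open Scope classical_set_scope.
Local Open Scope ring_scope.

Definition pochhammer (R : nzRingType) (x : R) (k : nat) : R :=
  \prod_(i < k) (x + i%:R).

Definition pearson (R : nzRingType) (theta sigma : {poly R}) (w : nat -> R) : Prop :=
  theta.[0] = 0 /\
  forall k : nat, theta.[k.+1%:R] * w k.+1 = sigma.[k%:R] * w k.

Definition meixner_weight (R : fieldType) (a b eta : R) (k : nat) : R :=
  pochhammer a k / pochhammer (b + 1) k * (eta ^+ k / k`!%:R).

Definition meixner_theta (R : nzRingType) (b : R) : {poly R} := 'X * ('X + b%:P).

Definition meixner_sigma (R : nzRingType) (a eta : R) : {poly R} :=
  eta *: ('X + a%:P).

Section Orthogonality.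
Context {R : realType}.
Implicit Types (w H beta gamma : nat -> R) (P : nat -> {poly R}).

(* For the generalized Meixner weight this series always converges, since
   w (k+1) / w k = eta (k + a) / ((k + 1) (k + b + 1)) tends to 0. *)
Definition moment w (n : nat) : R :=
  limn (series (fun k => k%:R ^+ n * w k)).

Definition hankel_det w (k : nat) : R :=
  \det (\matrix_(i < k, j < k) moment w (i + j)).

Definition monic_orthogonal w P H : Prop :=
  [/\ forall n, P n \is monic,
      forall n, size (P n) = n.+1,
      forall n m, series (fun k => (P n).[k%:R] * (P m).[k%:R] * w k) @ \oo -->
                  (if n == m then H n else 0)
    & forall n, H n != 0].

(* The last term is absent for n = 0, so gamma 0 plays no role. *)
Definition three_term_recurrence P beta gamma : Prop :=
  forall n, 'X * P n =
    P n.+1 + beta n *: P n + (if n is m.+1 then gamma n *: P m else 0).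

End Orthogonality.

(* Matrices with rows and columns indexed by nat. *)
Definition smatrix (R : Type) := nat -> nat -> R.

Section SemiInfinite.
Context {R : comNzRingType}.
Implicit Types A B : smatrix R.

(* A finitely supported sum: by convention 0 when infinitely many terms are
   nonzero, which does not happen when every row of A has finite support, as is
   the case for lower triangular and for banded matrices. *)
Definition smul A B : smatrix R :=
  fun n m => \sum_(k \in [set: nat]) A n k * B k m.

Definition sid : smatrix R := fun n m => (n == m)%:R.

Definition sdiag (d : nat -> R) : smatrix R :=
  fun n m => if n == m then d n else 0.

Definition strmx A : smatrix R := fun n m => A m n.

Definition sexp A (i : nat) : smatrix R := iter i (smul A) sid.

Definition shorner (p : {poly R}) A : smatrix R :=
  fun n m => \sum_(i < size p) p`_i * sexp A i n m.

Definition lower_unitriangular A : Prop :=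
  (forall n, A n n = 1) /\ (forall n m, (n < m)%N -> A n m = 0).

(* B is the inverse of A in the group of lower unitriangular matrices. *)
Definition lower_unitriangular_inverse A B : Prop :=
  [/\ lower_unitriangular B,
      forall n m, smul A B n m = sid n m
    & forall n m, smul B A n m = sid n m].

Definition jacobi (beta gamma : nat -> R) : smatrix R :=
  fun n m => if m == n then beta n
             else if m == n.+1 then 1
             else if n == m.+1 then gamma n
             else 0.

(* P(z + 1) = Pi P(z) as an identity between columns of polynomials in z. *)
Definition dressed_pascal (P : nat -> {poly R}) (Pi : smatrix R) : Prop :=
  lower_unitriangular Pi /\
  forall n, P n \Po ('X + 1) = \sum_(k \in [set: nat]) Pi n k *: P k.

Definition laguerre_freud (theta : {poly R}) (H : nat -> R)
    (J Piinv : smatrix R) : smatrix R :=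
  smul Piinv (smul (sdiag H) (shorner theta (strmx J))).

End SemiInfinite.

Lemma meixner_pearson (R : realType) (a b eta : R)
    (hb : forall j : nat, b + 1 != - j%:R) :
  pearson (meixner_theta b) (meixner_sigma a eta) (meixner_weight a b eta).
Proof.
split; first by rewrite /meixner_theta hornerM hornerX mul0r.
move=> k; rewrite /meixner_theta /meixner_sigma /meixner_weight /pochhammer.
rewrite !hornerE !big_ord_recr /= exprS factS natrM.
have hk : b + 1 + k%:R != 0 by rewrite addr_eq0.
have -> : k.+1%:R + b = b + 1 + k%:R by rewrite -natr1 addrC addrA addrAC.
have hs : k.+1%:R != 0 :> R by rewrite pnatr_eq0.
have hf : k`!%:R != 0 :> R by rewrite pnatr_eq0 -lt0n fact_gt0.
have hp : \prod_(i < k) (b + 1 + i%:R) != 0.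
  by apply/prodf_neq0 => i _; rewrite addr_eq0.
move: hk hs hf hp; rewrite [k%:R + a]addrC.
move: (b + 1 + _) k.+1%:R k`!%:R (\prod_(i < k) (b + _ + _)).
move: (a + k%:R) (\prod_(i < k) (a + _)) (eta ^+ k).
by move=> u v e x y z t hx hy hz ht; field; rewrite hx hy hz ht.
Qed.

(* Main.v *)
(** Write L(q) for the sum of q(k) w(k), defined for every polynomial q.
    Expanding P_n(z - 1) and theta P_m in the basis P gives
    Psi_(n,m) = L(P_n(z - 1) theta(z) P_m(z)), and shifting the summation index
    by means of the Pearson equation turns this into L(P_n sigma P_m(z + 1)).
    By orthogonality the first form vanishes above the second superdiagonal and
    the second one below the first subdiagonal; on the four remaining diagonals
    L(P_m q) is determined by the two leading coefficients of q. *)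

Require Import Defs.
From mathcomp Require Import all_boot all_order all_algebra.
From mathcomp Require Import all_classical all_reals all_analysis.
From mathcomp Require Import ring.

Import Order.TTheory GRing.Theory Num.Theory.
Import numFieldNormedType.Exports.
Local Open Scope ring_scope.

(** * Finitely supported sums and powers of the transposed Jacobi matrix *)

Lemma fsum_nat (R : nmodType) (F : nat -> R) (N : nat) :
  (forall k, (N <= k)%N -> F k = 0) ->
  \sum_(k \in [set: nat]) F k = \sum_(k < N) F k.
Proof.
move=> F0; rewrite fsbig_ord; apply/esym/fsbig_widen => //= k [_ /= /negP].
by rewrite -leqNgt => /F0.
Qed.

Section SemiInfinite.
Context {R : comNzRingType}.
Implicit Types (A B : smatrix R) (beta gamma : nat -> R).

Lemma smulE A B n m N :
  (forall k, (N <= k)%N -> A n k * B k m = 0) ->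
  smul A B n m = \sum_(k < N) A n k * B k m.
Proof. exact: fsum_nat. Qed.

Lemma smul_sdiag (d : nat -> R) B n m : smul (sdiag d) B n m = d n * B n m.
Proof.
rewrite (smulE _ _ _ _ n.+1) => [|k nk]; last first.
  by rewrite /sdiag ltn_eqF ?mul0r.
rewrite big_ord_recr /= /sdiag eqxx big1 ?add0r // => k _.
by rewrite gtn_eqF ?mul0r.
Qed.

Lemma jacobi0 beta gamma n m : (n.+1 < m)%N -> jacobi beta gamma n m = 0.
Proof.
move=> nm; rewrite /jacobi gtn_eqF ?(ltnW nm) // gtn_eqF // ltn_eqF //.
by rewrite ltnS ltnW // ltnW.
Qed.

(** Each factor J^T extends the support of a column by at most one row. Hence the sums that define
    these powers are finite, and [smul] never falls back on its default value 0. *)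
Lemma sexp_jacobi0 beta gamma i k m : (m + i < k)%N ->
  sexp (strmx (jacobi beta gamma)) i k m = 0.
Proof.
elim: i k => [|i IH] k mk; first by rewrite /sexp /= /sid gtn_eqF // -[m]addn0.
rewrite /sexp /= (smulE _ _ _ _ (m + i).+1) => [|l ml].
  rewrite big1 // => l _; rewrite /strmx jacobi0 ?mul0r //.
  by rewrite (leq_ltn_trans _ mk) // addnS ltn_ord.
by rewrite [iter _ _ _ _ _]IH ?mulr0.
Qed.

End SemiInfinite.

(** * Expansions in the basis [P] *)

Section BandedExpansion.
Context {R : realType}.
Implicit Types (P : nat -> {poly R}) (beta gamma : nat -> R).

Lemma mulX_jacobi P beta gamma n N : three_term_recurrence P beta gamma ->
  (n.+1 < N)%N -> 'X * P n = \sum_(k < N) jacobi beta gamma n k *: P k.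
Proof.
move=> hrec nN; rewrite hrec.
rewrite -(big_mkord xpredT (fun k => jacobi beta gamma n k *: P k)).
rewrite (big_cat_nat _ (n := n.+2)) //= addrC big_nat big1 ?add0r; last first.
  by move=> k /andP[nk _]; rewrite jacobi0 ?scale0r.
rewrite big_mkord !big_ord_recr /= /jacobi eqxx gtn_eqF // eqxx scale1r.
rewrite [RHS]addrC -addrA; congr (_ + _); rewrite addrC; congr (_ + _).
case: n {nN} => [|n]; first by rewrite big_ord0.
rewrite big_ord_recr /= big1 ?add0r => [|k _].
  by rewrite ltn_eqF // ltn_eqF // eqxx.
have kn := ltn_ord k; have kn1 := leqW kn.
by rewrite (ltn_eqF kn1) (ltn_eqF (leqW kn1)) eqSS (gtn_eqF kn) scale0r.
Qed.

(** Induction on [i]: multiplying P_l by ['X] produces row l of J, which is column l of J^T. *)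
Lemma mulXn_jacobi P beta gamma i m : three_term_recurrence P beta gamma ->
  forall N, (m + i < N)%N -> 'X^i * P m =
    \sum_(k < N) sexp (strmx (jacobi beta gamma)) i k m *: P k.
Proof.
move=> hrec; elim: i => [|i IH] N mN.
  rewrite addn0 in mN; rewrite mul1r (bigD1 (Ordinal mN)) //= /sexp /= /sid.
  rewrite eqxx scale1r big1 ?addr0 // => k /negPf km.
  by rewrite -val_eqE /= in km; rewrite km scale0r.
(* Cutting the inner sum at m + i + 1 gives l + 1 < N for each of its indices l, as the one-step
   expansion requires. *)
rewrite exprS -mulrA (IH (m + i).+1) // mulr_sumr.
under eq_bigr => l _.
  rewrite -scalerAr (mulX_jacobi _ _ _ _ N hrec); last first.
    by rewrite (leq_ltn_trans _ mN) // addnS ltn_ord.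
  rewrite scaler_sumr; over.
rewrite exchange_big; apply: eq_bigr => k _ /=.
rewrite {2}/sexp /= (smulE _ _ _ _ (m + i).+1) => [|l ml].
  by rewrite scaler_suml; apply: eq_bigr => l _; rewrite scalerA mulrC.
by rewrite [iter _ _ _ _ _]sexp_jacobi0 ?mulr0.
Qed.

Lemma mul_shorner_jacobi P beta gamma (p : {poly R}) m N :
  three_term_recurrence P beta gamma -> (m + size p <= N)%N ->
  p * P m = \sum_(k < N) shorner p (strmx (jacobi beta gamma)) k m *: P k.
Proof.
move=> hrec mN; rewrite -{1}[p]coefK poly_def mulr_suml.
under eq_bigr => i _.
  rewrite -scalerAl (mulXn_jacobi _ _ _ _ _ hrec N); last first.
    by rewrite (leq_trans _ mN) // ltn_add2l.
  rewrite scaler_sumr; over.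
rewrite exchange_big; apply: eq_bigr => k _ /=.
by rewrite /shorner scaler_suml; apply: eq_bigr => i _; rewrite scalerA.
Qed.

(** Applying [Piinv] to P(z + 1) = Pi P(z) gives Piinv P(z + 1) = P(z); then z is replaced by z -
    1. *)
Lemma comp_poly_inv_dressed_pascal P (Pi Piinv : smatrix R) n :
  dressed_pascal P Pi -> lower_unitriangular_inverse Pi Piinv ->
  P n \Po ('X - 1) = \sum_(k < n.+1) Piinv n k *: P k.
Proof.
move=> [[Pi1 Pi0] hPi] [[_ Q0] _ QP].
(* All rows k <= n are cut at the same length, so that the two sums can be exchanged. *)
have PE k : (k < n.+1)%N -> P k \Po ('X + 1) = \sum_(j < n.+1) Pi k j *: P j.
  move=> kn; rewrite hPi; apply: fsum_nat => j nj.
  by rewrite Pi0 ?scale0r // (leq_trans kn).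
suff {1}-> : P n = \sum_(k < n.+1) Piinv n k *: (P k \Po ('X + 1)).
  rewrite linear_sum /=; apply: eq_bigr => k _.
  by rewrite linearZ /= -polyC1 comp_polyXaddC_K.
under eq_bigr => k _ do rewrite PE // scaler_sumr.
rewrite exchange_big /=.
transitivity (\sum_(j < n.+1) sid n j *: P j).
  rewrite (bigD1 ord_max) //= /sid eqxx scale1r big1 ?addr0 // => j /negPf.
  by rewrite -val_eqE eq_sym /= => ->; rewrite scale0r.
apply: eq_bigr => j _; rewrite -QP (smulE _ _ _ _ n.+1) => [|k nk].
  by rewrite scaler_suml; apply: eq_bigr => k _; rewrite scalerA.
by rewrite Q0 ?mul0r.
Qed.

End BandedExpansion.

(* The factor 'X keeps the subleading coefficient at index n, so that n = 0 needs
   no special treatment. *)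
Lemma coef_comp_XaddC (R : comNzRingType) (c : R) n (p : {poly R}) :
  (size p <= n.+1)%N ->
  (p \Po ('X + c%:P))`_n = p`_n /\
  ('X * (p \Po ('X + c%:P)))`_n = ('X * p)`_n + n%:R * c * p`_n.
Proof.
elim: n p => [|n IH] p; [move/size1_polyC=> -> | elim/poly_ind: p => [|p d _]].
- by rewrite comp_polyC !coefXM !eqxx mul0r mul0r addr0.
- by rewrite comp_poly0 !mulr0 !coef0 mulr0 addr0.
have [->|p0] := eqVneq p 0.
  rewrite mul0r add0r comp_polyC !coefXM !coefC /= mulr0 addr0 => _.
  by split.
rewrite size_MXaddC (negPf p0) /= ltnS => pn; have [e1 e2] := IH _ pn.
have e3 : (p \Po ('X + c%:P))`_n.+1 = 0.
  rewrite nth_default // (leq_trans (size_comp_poly_leq _ _)) //.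
  by rewrite size_XaddC muln1 prednK ?size_poly_gt0.
rewrite comp_poly_MXaddC mulrDr (mulrC p) (mulrC _ 'X) (mulrC _ c%:P).
rewrite !coefXM /= !coefD e2 !coefCM e1 !coefXM !coefC /= addr0 !addr0 -natr1.
by rewrite e3 mulr0 addr0; split=> //; case: (n == 0%N); ring.
Qed.

(** * The functional L and its values on multiples of P_m *)

Section OrthogonalPolynomials.
Context {R : realType}.
Implicit Types (w H beta gamma : nat -> R) (P : nat -> {poly R}).

(** The relation L(q) = l carries convergence along with the value, so that linearity needs no
    separate summability proofs. *)
Definition weighted_sum_cvg w (q : {poly R}) (l : R) : Prop :=
  (series (fun k => q.[k%:R] * w k) @ \oo --> l)%classic.

Lemma weighted_sum_unique w q l l' :
  weighted_sum_cvg w q l -> weighted_sum_cvg w q l' -> l = l'.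
Proof. exact: cvg_unique. Qed.

Lemma weighted_sum0 w : weighted_sum_cvg w 0 0.
Proof.
rewrite /weighted_sum_cvg.
have -> : (fun k => (0 : {poly R}).[k%:R] * w k) = fun=> 0.
  by apply/funext => k; rewrite horner0 mul0r.
have -> : series (fun=> 0 : R) = fun=> 0.
  by apply/funext => k; rewrite /series /= big1.
exact: cvg_cst.
Qed.

Lemma weighted_sumD w p q l l' : weighted_sum_cvg w p l ->
  weighted_sum_cvg w q l' -> weighted_sum_cvg w (p + q) (l + l').
Proof.
move=> hp hq; rewrite /weighted_sum_cvg.
have -> : (fun k => (p + q).[k%:R] * w k) =
          (fun k => p.[k%:R] * w k) + (fun k => q.[k%:R] * w k).
  by apply/funext => k; rewrite hornerD mulrDl.
rewrite seriesD; exact: cvgD.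
Qed.

Lemma weighted_sumZ w c p l : weighted_sum_cvg w p l ->
  weighted_sum_cvg w (c *: p) (c * l).
Proof.
move=> hp; rewrite /weighted_sum_cvg.
have -> : (fun k => (c *: p).[k%:R] * w k) = c *: (fun k => p.[k%:R] * w k).
  by apply/funext => k; rewrite hornerZ -mulrA.
rewrite seriesZ; exact: cvgZr.
Qed.

Lemma weighted_sum_sum w N (p : 'I_N -> {poly R}) (l : 'I_N -> R) :
  (forall i, weighted_sum_cvg w (p i) (l i)) ->
  weighted_sum_cvg w (\sum_i p i) (\sum_i l i).
Proof.
move=> hp; apply: (big_rec2 (fun q s => weighted_sum_cvg w q s)) => [|i s q _].
  exact: weighted_sum0.
exact: weighted_sumD.
Qed.

(** The term of theta(z) q(z - 1) at k = 0 vanishes since theta(0) = 0, and its term at k + 1 equals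
    that of sigma q at k. The partial sums thus agree up to an index shift. *)
Lemma weighted_sum_pearson w (theta sigma q : {poly R}) l :
  pearson theta sigma w -> weighted_sum_cvg w (theta * (q \Po ('X - 1))) l ->
  weighted_sum_cvg w (sigma * q) l.
Proof.
move=> [theta0 hw]; rewrite /weighted_sum_cvg -cvg_shiftS.
suff -> : [sequence series (fun k => (theta * (q \Po ('X - 1))).[k%:R] * w k) n.+1]_n
  = series (fun k => (sigma * q).[k%:R] * w k) by [].
apply/funext => n.
rewrite /series /= big_nat_recl // hornerM theta0 !mul0r add0r.
apply: eq_bigr => k _; rewrite !hornerM horner_comp mulrAC hw mulrAC.
by rewrite !hornerE -natr1 addrK.
Qed.

Lemma weighted_sum_orthogonal w P H (n m : nat) : monic_orthogonal w P H ->
  weighted_sum_cvg w (P n * P m) (if n == m then H n else 0).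
Proof.
case=> _ _ hPP _; rewrite /weighted_sum_cvg.
have -> // : (fun k => (P n * P m).[k%:R] * w k) =
          (fun k => (P n).[k%:R] * (P m).[k%:R] * w k).
by apply/funext => k; rewrite hornerM.
Qed.

Lemma monic_orthogonal_lead w P H n : monic_orthogonal w P H -> (P n)`_n = 1.
Proof.
by case=> hm hs _ _; have /monicP := hm n; rewrite lead_coefE hs.
Qed.

(** Multiples of P_N strip q of its top terms one degree at a time; only N = m pairs with P_m to a
    nonzero value. *)
Lemma weighted_sum_lead w P H m (q : {poly R}) : monic_orthogonal w P H ->
  (size q <= m.+1)%N -> weighted_sum_cvg w (P m * q) (q`_m * H m).
Proof.
(* The size bound becomes a variable N <= m + 1 for the induction, while m itself stays fixed. *)
move=> hP; move: {-2}m.+1 (leqnn m.+1) => N.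
elim: N q => [|N IH] q Nm.
  rewrite leqn0 size_poly_eq0 => /eqP ->.
  by rewrite mulr0 coef0 mul0r; exact: weighted_sum0.
move=> qN; have [_ hs _ _] := hP.
pose r := q - q`_N *: P N.
have rN : (size r <= N)%N.
  apply/leq_sizeP => j; rewrite leq_eqVlt => /predU1P[<-|Nj].
    by rewrite coefB coefZ (monic_orthogonal_lead _ _ _ _ hP) mulr1 subrr.
  rewrite coefB coefZ (nth_default _ (leq_trans qN Nj)) sub0r.
    by rewrite [(P _)`_j]nth_default ?hs // mulr0 oppr0.
have -> : q = r + q`_N *: P N by rewrite subrK.
rewrite mulrDr -scalerAr coefD mulrDl coefZ.
apply: weighted_sumD; first exact: IH (ltnW Nm) rN.
rewrite -mulrA; apply: weighted_sumZ.
have := weighted_sum_orthogonal _ _ _ m N hP.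
case: eqP => [<-|/eqP mN]; first by rewrite (monic_orthogonal_lead _ _ _ _ hP) mul1r.
rewrite ltnS leq_eqVlt eq_sym (negPf mN) /= in Nm.
by rewrite [(P N)`_m]nth_default ?mul0r // hs.
Qed.

(** Subtracting the multiple of P_(m+1) that cancels the top coefficient leaves the pairing with P_m
    unchanged and the degree at most m. *)
Lemma weighted_sum_sublead w P H m (q : {poly R}) : monic_orthogonal w P H ->
  (size q <= m.+2)%N ->
  weighted_sum_cvg w (P m * q) ((q`_m - q`_m.+1 * (P m.+1)`_m) * H m).
Proof.
move=> hP qm; have [_ hs _ _] := hP.
pose r := q - q`_m.+1 *: P m.+1.
have rm : (size r <= m.+1)%N.
  apply/leq_sizeP => j; rewrite leq_eqVlt => /predU1P[<-|mj].
    by rewrite coefB coefZ (monic_orthogonal_lead _ _ _ _ hP) mulr1 subrr.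
  rewrite coefB coefZ (nth_default _ (leq_trans qm mj)) sub0r.
    by rewrite [(P _)`_j]nth_default ?hs // mulr0 oppr0.
have {1}-> : q = r + q`_m.+1 *: P m.+1 by rewrite subrK.
rewrite mulrDr -scalerAr -[X in weighted_sum_cvg _ _ X]addr0.
apply: weighted_sumD.
  by have := weighted_sum_lead _ _ _ _ _ hP rm; rewrite coefB coefZ.
rewrite -[X in weighted_sum_cvg _ _ X](mulr0 q`_m.+1); apply: weighted_sumZ.
by have := weighted_sum_orthogonal _ _ _ m m.+1 hP; rewrite ltn_eqF.
Qed.

(** Orthogonality collapses the product of the two expansions to the pairings H_k, the diagonal
    middle factor of Psi. *)
Lemma weighted_sum_laguerre_freud w P H beta gamma (theta : {poly R})
    (Pi Piinv : smatrix R) n m :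
  monic_orthogonal w P H -> three_term_recurrence P beta gamma ->
  dressed_pascal P Pi -> lower_unitriangular_inverse Pi Piinv ->
  weighted_sum_cvg w ((P n \Po ('X - 1)) * (theta * P m))
    (laguerre_freud theta H (jacobi beta gamma) Piinv n m).
Proof.
move=> hP hrec hPi hQ; have [[_ Q0] _ _] := hQ.
rewrite (comp_poly_inv_dressed_pascal _ _ _ _ hPi hQ).
rewrite /laguerre_freud (smulE _ _ _ _ n.+1) => [|k nk]; last first.
  by rewrite Q0 ?mul0r.
rewrite mulr_suml; apply: weighted_sum_sum => k.
rewrite -scalerAl; apply: weighted_sumZ; rewrite smul_sdiag.
(* Long enough for the expansion of theta P_m, and larger than k so that the diagonal index j = k
   occurs. *)
pose N := (m + size theta + k.+1)%N.
have kN : (k < N)%N by rewrite /N leq_addl.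
rewrite (mul_shorner_jacobi _ _ _ _ _ N hrec) ?leq_addr // mulr_sumr.
set T := shorner _ _.
have -> : H k * T k m =
    \sum_(j < N) T j m * (if k == j :> nat then H k else 0).
  rewrite (bigD1 (Ordinal kN)) //= eqxx mulrC big1 ?addr0 // => j.
  by rewrite -val_eqE eq_sym /= => /negPf ->; rewrite mulr0.
apply: weighted_sum_sum => j; rewrite -scalerAr; apply: weighted_sumZ.
exact: weighted_sum_orthogonal.
Qed.

End OrthogonalPolynomials.

(** * The entries of Psi for the generalized Meixner weight *)

Theorem theorem6 (R : realType) (a b eta : R)
    (hab : 0 < a * (b + 1)) (heta : 0 < eta)
    (hb : forall j : nat, b + 1 != - j%:R)
    (hHankel : forall k : nat, (0 < k)%N ->
       hankel_det (meixner_weight a b eta) k != 0)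
    (P : nat -> {poly R}) (H beta gamma : nat -> R)
    (hP : monic_orthogonal (meixner_weight a b eta) P H)
    (hrec : three_term_recurrence P beta gamma)
    (Pi Piinv : smatrix R)
    (hPi : dressed_pascal P Pi)
    (hPiinv : lower_unitriangular_inverse Pi Piinv) :
  let Psi := laguerre_freud (meixner_theta b) H (jacobi beta gamma) Piinv in
  forall n : nat,
    [/\ Psi n.+1 n = eta * H n.+1,
        Psi n n = eta * (beta n + a + n%:R) * H n,
        Psi n n.+1 = (beta n + beta n.+1 + b - n%:R) * H n.+1,
        Psi n n.+2 = H n.+2
      & forall m : nat, (m.+1 < n)%N || (n.+2 < m)%N -> Psi n m = 0].
Proof.
move=> Psi; set w := meixner_weight a b eta in hP *.
pose u n := P n \Po ('X - 1); pose v n := P n \Po ('X + 1).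
have [_ sP _ _] := hP; have P1 n := monic_orthogonal_lead _ _ _ n hP.
have usum n m : weighted_sum_cvg w (P m * (meixner_theta b * u n)) (Psi n m).
  have -> : P m * (meixner_theta b * u n) = u n * (meixner_theta b * P m) by ring.
  exact: weighted_sum_laguerre_freud hP hrec hPi hPiinv.
(* Pearson shift of q(z) = P_n(z) P_m(z + 1), for which q(z - 1) = P_n(z - 1) P_m(z). *)
have vsum n m : weighted_sum_cvg w (P n * (meixner_sigma a eta * v m)) (Psi n m).
  rewrite mulrCA; apply: weighted_sum_pearson (meixner_pearson _ _ hb) _.
  rewrite comp_polyM /v -polyC1 comp_polyXaddC_K polyC1.
  have -> : meixner_theta b * ((P n \Po ('X - 1)) * P m) =
            P m * (meixner_theta b * u n) by rewrite /u; ring.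
  exact: usum.
have thetaE (p : {poly R}) : meixner_theta b * p = 'X * ('X * p) + b *: ('X * p).
  by rewrite /meixner_theta -mul_polyC; ring.
have sigmaE (p : {poly R}) : meixner_sigma a eta * p = eta *: ('X * p + a *: p).
  by rewrite /meixner_sigma -!mul_polyC; ring.
have su n : size (u n) = n.+1.
  by rewrite /u -polyC1 -polyCN size_comp_poly2 ?sP ?size_XaddC.
have sv n : size (v n) = n.+1.
  by rewrite /v -polyC1 size_comp_poly2 ?sP ?size_XaddC.
have [u1 u2] : (forall n, (u n)`_n = 1) /\
    (forall n, ('X * u n)`_n = ('X * P n)`_n - n%:R).
  split=> n; have [] := @coef_comp_XaddC _ (-1) n (P n);
    by rewrite ?sP // polyCN polyC1 P1 // mulr1 mulrN1.
have [v1 v2] : (forall n, (v n)`_n = 1) /\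
    (forall n, ('X * v n)`_n = ('X * P n)`_n + n%:R).
  split=> n; have [] := @coef_comp_XaddC _ 1 n (P n);
    by rewrite ?sP // polyC1 P1 // !mulr1.
have sXu n : size ('X * u n) = n.+2.
  by rewrite mulrC size_mulX ?su // -size_poly_gt0 su.
have sXv n : size ('X * v n) = n.+2.
  by rewrite mulrC size_mulX ?sv // -size_poly_gt0 sv.
(* Coefficient of z^n in the recurrence: the gamma term has too low a degree, so beta_n is a
   difference of subleading coefficients. *)
have XP n : ('X * P n)`_n = (P n.+1)`_n + beta n.
  rewrite hrec !coefD coefZ P1 mulr1; case: n => [|n]; rewrite ?coef0 ?addr0 //.
  by rewrite coefZ [(P n)`__]nth_default ?sP // mulr0 addr0.
have sthetau n : (size (meixner_theta b * u n)%R <= n.+3)%N.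
  rewrite thetaE (leq_trans (size_polyD _ _)) // geq_max (mulrC 'X ('X * _)).
  rewrite size_mulX -?size_poly_gt0 sXu // leqnn.
  by rewrite (leq_trans (size_scale_leq _ _)) // sXu.
have ssigmav n : (size (meixner_sigma a eta * v n)%R <= n.+2)%N.
  rewrite sigmaE (leq_trans (size_scale_leq _ _)) //.
  rewrite (leq_trans (size_polyD _ _)) // geq_max sXv leqnn.
  by rewrite (leq_trans (size_scale_leq _ _)) // sv.
have sigma_lead n : (meixner_sigma a eta * v n)`_n.+1 = eta.
  rewrite sigmaE coefZ coefD coefZ coefXM /= v1.
  by rewrite [(v n)`__]nth_default ?sv // mulr0 addr0 mulr1.
have theta_lead n : (meixner_theta b * u n)`_n.+2 = 1.
  rewrite thetaE coefD coefZ !coefXM /= u1.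
  by rewrite [(u n)`__]nth_default ?su // mulr0 addr0.
move=> n; split.
(* Subdiagonal: sigma P_n(z + 1) has degree n + 1 and leading coefficient [eta]. *)
- apply: weighted_sum_unique (vsum _ _) _; rewrite -{2}(sigma_lead n).
  exact: weighted_sum_lead hP (ssigmav n).
(* Diagonal: the same polynomial against P_n; the subleading coefficient of P_(n+1) cancels and
   leaves beta_n. *)
- apply: weighted_sum_unique (vsum _ _) _.
  have := weighted_sum_sublead _ _ _ _ _ hP (ssigmav n).
  rewrite sigma_lead sigmaE coefZ coefD v2 coefZ v1 XP.
  by congr weighted_sum_cvg; ring.
- apply: weighted_sum_unique (usum _ _) _.
  have := weighted_sum_sublead _ _ _ _ _ hP (sthetau n).
  rewrite theta_lead thetaE coefD coefZ coefXM /= u2 XP coefXM /= u1.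
  (* The recurrence at n + 1 trades the subleading coefficient of P_(n+1) for that of P_(n+2), which
     cancels and leaves beta_(n+1). *)
  have := XP n.+1; rewrite coefXM /= => ->.
  by congr weighted_sum_cvg; ring.
- apply: weighted_sum_unique (usum _ _) _.
  by have := weighted_sum_lead _ _ _ _ _ hP (sthetau n); rewrite theta_lead mul1r.
(* Off the band, one of the two forms pairs P_n or P_m with a polynomial of lower degree. *)
- move=> m /orP[mn|nm].
  + apply: weighted_sum_unique (vsum _ _) _.
    have := weighted_sum_lead _ _ _ _ (meixner_sigma a eta * v m) hP.
    move=> /(_ n); rewrite nth_default ?mul0r; last exact: leq_trans (ssigmav m) mn.
    by apply; rewrite (leq_trans (ssigmav m)) // ltnW.
  + apply: weighted_sum_unique (usum _ _) _.
    have := weighted_sum_lead _ _ _ _ (meixner_theta b * u n) hP.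
    move=> /(_ m); rewrite nth_default ?mul0r; last exact: leq_trans (sthetau n) nm.
    by apply; rewrite (leq_trans (sthetau n)) // ltnW.
Qed.
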